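(* Let $f(\mathbf x)=N(\mathbf x)/Q(\mathbf x)$ be an arithmetic expression whose outermost operation (the $k$-th of its $k$ operation occurrences) is a division, where $N$ and $Q$ are division-free and $Q(\mathbf x)\ne0$ for all $\mathbf x\in I_1\times\cdots\times I_m$; let $\tilde f$ be its floating-point model, assumed defined for all $\mathbf x$ in the ranges and all admissible $\mathbf e,\mathbf d$. For $i=1,\dots,k$ let $h_i(\mathbf x)=\frac{\partial\tilde f}{\partial e_i}(\mathbf x,\mathbf 0,\mathbf 0)\cdot(Q(\mathbf x))^2$ (written as polynomials in $\mathbf x$) and let $p$ be the output of the PN decomposition procedure applied to $h_1,\dots,h_k$. Let $c\in(0,1)$ and let $n\ge2$ be even. For $u\in\mathbb R$ let $K_u(\mathbf x)=p(\mathbf x)\epsilon-(Q(\mathbf x))^2u$, $\mu_u=\mathbb E[K_u(\mathbf x)]$ and $\mathrm{flag}_u=\mathbb E[(K_u(\mathbf x)-\mu_u)^n]/\mu_u^n$. Let $\ell=\mathbb E[p(\mathbf x)]\cdot\epsilon/\mathbb E[(Q(\mathbf x))^2]$ and $r=10^5\ell$, and suppose $U_c^{(1)}\in(\ell,r)$ satisfies $\mathrm{flag}_{U_c^{(1)}}\le1-c$ (as found by binary search). Let $U^{(2)}$ be any real number with $|R_2(\mathbf x,\mathbf e,\mathbf d)|\le U^{(2)}$ for all $\mathbf x\in I_1\times\cdots\times I_m$ and all admissible $\mathbf e,\mathbf d$, and let $U_c^*=U_c^{(1)}+U^{(2)}$. Then for every pair of random vectors $\mathbf e,\mathbf d$ (on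 the same probability space as $\mathbf x$) taking admissible values almost surely, $$\mathbb P[\mathrm{err}(f,\mathbf x)\ge U_c^*]\le1-c.$$
   Context: Arithmetic expression: built from real variables $\mathbf x=(x_1,\dots,x_m)$ and real constants using $+,-,\times,/$, operation occurrences numbered $1,\dots,k$; division-free means no division by a non-constant subexpression. Floating-point model: for constants $\epsilon,\delta>0$, $\tilde f(\mathbf x,\mathbf e,\mathbf d)$, $\mathbf e=(e_1,\dots,e_k)$, $\mathbf d=(d_1,\dots,d_k)$, is obtained by recursively replacing the $i$-th operation occurrence $a\circ b$ by $(a\circ b)(1+e_i)+d_i$, so $\tilde f(\mathbf x,\mathbf 0,\mathbf 0)=f(\mathbf x)$. Admissible: $|e_i|\le\epsilon$, $|d_i|\le\delta$. Inputs: $x_1,\dots,x_m$ independent real random variables, $x_j$ taking values in a bounded interval $I_j$; $\mathbb P,\mathbb E$ denote probability and expectation. $R_2(\mathbf x,\mathbf e,\mathbf d)=\tilde f(\mathbf x,\mathbf e,\mathbf d)-f(\mathbf x)-\sum_{i=1}^k\frac{\partial\tilde f}{\partial e_i}(\mathbf x,\mathbf 0,\mathbf 0)e_i$; $\mathrm{err}(f,\mathbf x)=|\tilde f(\mathbf x,\mathbf e,\mathbf d)-f(\mathbf x)|$. PN decomposition: for real $y$, $y^+=\max\{y,0\}$, $y^-=\max\{-y,0\}$; a term is $c\,y_1^{a_1}\cdots y_r^{a_r}$ with nonzero coefficient $c$, each $y_l^{a_l}$ a factor; polynomial form means a finite sum of terms. On input polynomials $g_1,\dots,g_k$: start with $p:=0$;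 for each $i$: expand $g_i$ into polynomial form in $x_1,\dots,x_m$; replace each factor $x_j^a$ with $a$ odd by $(x_j^+)^a-(x_j^-)^a$ if $I_j$ contains both positive and negative values, by $-(x_j^-)^a$ if $I_j\subseteq(-\infty,0]$, leaving it unchanged otherwise; expand again into polynomial form in symbols $x_j,x_j^+,x_j^-$ (possibly using $x_j^+x_j^-=0$); let $g_i^+$ be the sum of terms with positive coefficient and $g_i^-$ minus the sum of terms with negative coefficient; set $p:=p+g_i^++g_i^-$. $p(\mathbf x)$ denotes the value of $p$ with $x_j^\pm$ set to $\max\{\pm x_j,0\}$. *)

(* Defs.v *)
From HB Require Import structures.
From mathcomp Require Import all_boot all_order all_algebra.
From mathcomp Require Import all_classical all_reals all_analysis.
(* The notations of mpoly clash with those of mathcomp-analysis. *)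
From mathcomp Require mpoly.
Import -(notations) mpoly.

Set Implicit Arguments.
Unset Strict Implicit.
Unset Printing Implicit Defensive.

Import Order.TTheory GRing.Theory Num.Theory.
Import numFieldNormedType.Exports.

Local Open Scope classical_set_scope.
Local Open Scope ring_scope.

Inductive binop := Add | Sub | Mul | Div.

Inductive expr (R : Type) (m : nat) : Type :=
| Var of 'I_m
| Cst of R
| Op of binop & expr R m & expr R m.

Arguments Var {R m} _.
Arguments Cst {R m} _.
Arguments Op {R m} _ _ _.

Section Expressions.
Context {R : realType} {m : nat}.
Implicit Types (t a b : expr R m) (x : 'I_m -> R).

Definition op_eval (o : binop) (u v : R) : R :=
  match o with
  | Add => u + v
  | Sub => u - v
  | Mul => u * v
  | Div => u / v
  end.

Fixpoint expr_eval t x : R :=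
  match t with
  | Var j => x j
  | Cst c => c
  | Op o a b => op_eval o (expr_eval a x) (expr_eval b x)
  end.

Fixpoint is_constant t : bool :=
  match t with
  | Var _ => false
  | Cst _ => true
  | Op _ a b => is_constant a && is_constant b
  end.

Fixpoint division_free t : bool :=
  match t with
  | Op Div a b => [&& division_free a, division_free b & is_constant b]
  | Op _ a b => division_free a && division_free b
  | _ => true
  end.

(* The k operation occurrences of t are indexed by 'I_(nops t) in postfix
   order: those of the left operand, those of the right operand, and last the
   outermost operation. *)
Fixpoint nops t : nat :=
  match t with
  | Op _ a b => nops a + nops b + 1
  | _ => 0
  end.

Definition lft_errs a b (e : 'I_(nops a + nops b + 1) -> R) :
    'I_(nops a) -> R :=
  fun i => e (lshift 1 (lshift (nops b) i)).

Definition rgt_errs a b (e : 'I_(nops a + nops b + 1) -> R) :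
    'I_(nops b) -> R :=
  fun i => e (lshift 1 (rshift (nops a) i)).

Definition top_err a b (e : 'I_(nops a + nops b + 1) -> R) : R :=
  e (rshift (nops a + nops b) ord0).

Fixpoint fl_eval t x : ('I_(nops t) -> R) -> ('I_(nops t) -> R) -> R :=
  match t return ('I_(nops t) -> R) -> ('I_(nops t) -> R) -> R with
  | Var j => fun _ _ => x j
  | Cst c => fun _ _ => c
  | Op o a b => fun e d =>
      op_eval o (fl_eval x (lft_errs e) (lft_errs d))
                (fl_eval x (rgt_errs e) (rgt_errs d)) * (1 + top_err e)
      + top_err d
  end.

(* Division is total in MathComp (u / 0 = 0), so that the floating-point model
   being defined has to be stated: every divisor is nonzero. *)
Fixpoint fl_defined t x : ('I_(nops t) -> R) -> ('I_(nops t) -> R) -> Prop :=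
  match t return ('I_(nops t) -> R) -> ('I_(nops t) -> R) -> Prop with
  | Var _ | Cst _ => fun _ _ => True
  | Op o a b => fun e d =>
      [/\ fl_defined x (lft_errs e) (lft_errs d),
          fl_defined x (rgt_errs e) (rgt_errs d) &
          o = Div -> fl_eval x (rgt_errs e) (rgt_errs d) <> 0]
  end.

Lemma fl_eval0 t x : @fl_eval t x (fun=> 0) (fun=> 0) = expr_eval t x.
Proof.
elim: t => //= o a IHa b IHb.
by rewrite /top_err /= addr0 addr0 mulr1 -IHa -IHb.
Qed.

(* The partial derivative of fl_eval t with respect to e_i at (x, 0, 0). *)
Definition fl_partial t x (i : 'I_(nops t)) : R :=
  derive1
    (fun s : R => @fl_eval t x (fun j => if j == i then s else 0) (fun=> 0)) 0.

Definition remainder2 t x (e d : 'I_(nops t) -> R) : R :=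
  fl_eval x e d - expr_eval t x - \sum_(i < nops t) fl_partial x i * e i.

Definition fl_err t x (e d : 'I_(nops t) -> R) : R :=
  `| fl_eval x e d - expr_eval t x |.

Definition in_box (I : 'I_m -> interval R) x : Prop := forall j, x j \in I j.

End Expressions.

Arguments fl_eval {R m} t x e d.
Arguments fl_defined {R m} t x e d.
Arguments fl_partial {R m} t x i.
Arguments remainder2 {R m} t x e d.
Arguments fl_err {R m} t x e d.

Definition admissible {R : realType} (k : nat) (eps delta : R)
    (e d : 'I_k -> R) : Prop :=
  (forall i, `|e i| <= eps) /\ (forall i, `|d i| <= delta).

Section PNDecomposition.
Context {R : realType} {m : nat}.
Implicit Types (I : 'I_m -> interval R).

(* The 3m symbols x_j, x_j^+, x_j^- as variables of a polynomial ring. *)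
Definition pn_nsym : nat := m + m + m.
Definition sym (j : 'I_m) : 'I_pn_nsym := lshift m (lshift m j).
Definition symp (j : 'I_m) : 'I_pn_nsym := lshift m (rshift m j).
Definition symn (j : 'I_m) : 'I_pn_nsym := rshift (m + m) j.

Definition symX (s : 'I_pn_nsym) : mpoly pn_nsym R := mpolyX R (mnm1 s).

Definition pn_point (x : 'I_m -> R) (s : 'I_pn_nsym) : R :=
  match fintype.split s with
  | inl s' => match fintype.split s' with
              | inl j => x j
              | inr j => Num.max (x j) 0
              end
  | inr j => Num.max (- x j) 0
  end.

Definition pn_value (p : mpoly pn_nsym R) (x : 'I_m -> R) : R :=
  meval (pn_point x) p.

Definition pn_factor I (j : 'I_m) (a : nat) : mpoly pn_nsym R :=
  if odd a then
    if `[< (exists2 y, y \in I j & 0 < y) /\ (exists2 y, y \in I j & y < 0) >]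
    then symX (symp j) ^+ a - symX (symn j) ^+ a
    else if `[< forall y, y \in I j -> y <= 0 >]
    then - symX (symn j) ^+ a
    else symX (sym j) ^+ a
  else symX (sym j) ^+ a.

Definition pn_subst I (g : mpoly m R) : mpoly pn_nsym R :=
  \sum_(M <- msupp g) mcoeff M g *: \prod_(j < m) pn_factor I j (M j).

(* q' is obtained from q by replacing by 0 some (possibly none) of the terms
   in which x_j^+ x_j^- occurs for some j. *)
Definition pn_simplifies (q q' : mpoly pn_nsym R) : Prop :=
  forall M : multinom pn_nsym,
    mcoeff M q' = mcoeff M q \/
    mcoeff M q' = 0 /\ exists j, (0 < M (symp j))%N /\ (0 < M (symn j))%N.

Definition pos_terms (q : mpoly pn_nsym R) : mpoly pn_nsym R :=
  \sum_(M <- msupp q | 0 < mcoeff M q) mcoeff M q *: mpolyX R M.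

Definition neg_terms (q : mpoly pn_nsym R) : mpoly pn_nsym R :=
  - \sum_(M <- msupp q | mcoeff M q < 0) mcoeff M q *: mpolyX R M.

Definition PN_output I (k : nat) (g : 'I_k -> mpoly m R)
    (p : mpoly pn_nsym R) : Prop :=
  exists q : 'I_k -> mpoly pn_nsym R,
    (forall i, pn_simplifies (pn_subst I (g i)) (q i)) /\
    p = \sum_(i < k) (pos_terms (q i) + neg_terms (q i)).

End PNDecomposition.

Arguments pn_nsym : clear implicits.

Section Probability.
Context {d : measure_display} {T : measurableType d} {R : realType}.
Variable P : probability T R.

Definition mutually_independent (m : nat) (X : 'I_m -> {RV P >-> R}) : Prop :=
  forall (J : {set 'I_m}) (B : 'I_m -> set R),
    (forall j, measurable (B j)) ->
    P (\big[setI/setT]_(j in J) (X j @^-1` B j)) =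
    (\prod_(j in J) P (X j @^-1` B j))%E.

Definition expect (Y : T -> R) : R := fine ('E_P[Y])%E.

Definition flag (n : nat) (Y : T -> R) : R :=
  expect (fun w => (Y w - expect Y) ^+ n) / expect Y ^+ n.

End Probability.

(* Main.v *)
Require Import Defs.
From HB Require Import structures.
From mathcomp Require Import all_boot all_order all_algebra.
From mathcomp Require Import all_classical all_reals all_analysis.
From mathcomp Require Import measurable_realfun.
From mathcomp Require mpoly.
Import -(notations) mpoly.
Import Order.TTheory GRing.Theory Num.Theory.
Import numFieldNormedType.Exports.
Local Open Scope classical_set_scope.
Local Open Scope ring_scope.

(** Every monomial produced by the PN substitution is nonnegative on the box, so
    [p] dominates the sum of the [|h_i|]. An error of size at least [U1 + U2]
    therefore forces [0 <= K U1], whereas [K U1] has negative mean because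
    [l < U1]; Markov's inequality for the [n]-th central moment bounds the
    probability of this event by the flag. *)

(** * Polynomials whose monomials are nonnegative at a given point *)

Section TermSigns.
Context {R : realType} {n : nat}.
Implicit Types (v : 'I_n -> R) (q : mpoly n R).

(** The sign condition is on the bare monomials and ignores their coefficients. It is therefore
    stable under negation and arbitrary scaling, and the sign of a term is the sign of its
    coefficient, which is what [pos_terms] and [neg_terms] sort by. *)
Definition terms_ge0 v q : Prop :=
  forall M, M \in msupp q -> 0 <= meval v (mpolyX R M).

Lemma terms_ge0D v q1 q2 :
  terms_ge0 v q1 -> terms_ge0 v q2 -> terms_ge0 v (q1 + q2).
Proof. by move=> t1 t2 M /msuppD_le; rewrite mem_cat => /orP[/t1|/t2]. Qed.

Lemma terms_ge0N v q : terms_ge0 v q -> terms_ge0 v (- q).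
Proof. by move=> tq M; rewrite (perm_mem (msuppN q)) => /tq. Qed.

Lemma terms_ge0Z v a q : terms_ge0 v q -> terms_ge0 v (a *: q).
Proof. by move=> tq M /msuppZ_le /tq. Qed.

(** Cancellation can only remove monomials, so each monomial left in the product is a product of one
    monomial from each factor. *)
Lemma terms_ge0M v q1 q2 :
  terms_ge0 v q1 -> terms_ge0 v q2 -> terms_ge0 v (q1 * q2).
Proof.
move=> t1 t2 M /msuppM_le /allpairsP[[M1 M2] /= [/t1 p1 /t2 p2 ->]].
by rewrite mpolyXD mevalM mulr_ge0.
Qed.

Lemma terms_ge0_sum (A : Type) v (r : seq A) (F : A -> mpoly n R) :
  (forall i, terms_ge0 v (F i)) -> terms_ge0 v (\sum_(i <- r) F i).
Proof.
move=> tF; apply: (big_ind (terms_ge0 v)) => //; last exact: terms_ge0D.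
by move=> M; rewrite [msupp _]msupp0.
Qed.

Lemma terms_ge0_prod (A : Type) v (r : seq A) (F : A -> mpoly n R) :
  (forall i, terms_ge0 v (F i)) -> terms_ge0 v (\prod_(i <- r) F i).
Proof.
move=> tF; apply: (big_ind (terms_ge0 v)) => //; last exact: terms_ge0M.
move=> M; rewrite [msupp _]msupp1 inE => /eqP ->.
by rewrite mpolyX0 meval1.
Qed.

Lemma terms_ge0_Xn v i a :
  0 <= v i ^+ a -> terms_ge0 v (mpolyX R (mnm1 i) ^+ a).
Proof.
move=> va M; rewrite mpolyXn msuppX inE => /eqP ->.
by rewrite -mpolyXn rmorphXn /= mevalXU.
Qed.

End TermSigns.

(** * Values and term signs of the PN decomposition on the box *)

Section PNValue.
Context {R : realType} {m : nat}.
Implicit Types (I : 'I_m -> interval R) (x : 'I_m -> R).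
Implicit Types (q : mpoly (pn_nsym m) R).

Lemma pn_point_sym x j : pn_point x (sym j) = x j.
Proof. by rewrite /pn_point /sym (unsplitK (inl _)) (unsplitK (inl _)). Qed.

Lemma pn_point_symp x j : pn_point x (symp j) = Num.max (x j) 0.
Proof. by rewrite /pn_point /symp (unsplitK (inl _)) (unsplitK (inr _)). Qed.

Lemma pn_point_symn x j : pn_point x (symn j) = Num.max (- x j) 0.
Proof. by rewrite /pn_point /symn (unsplitK (inr _)). Qed.

Lemma pn_point_symp_ge0 x j : 0 <= pn_point x (symp j).
Proof. by rewrite pn_point_symp le_max lexx orbT. Qed.

Lemma pn_point_symn_ge0 x j : 0 <= pn_point x (symn j).
Proof. by rewrite pn_point_symn le_max lexx orbT. Qed.

Lemma meval_symXn x s a : meval (pn_point x) (symX s ^+ a) = pn_point x s ^+ a.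
Proof. by rewrite rmorphXn /= mevalXU. Qed.

(** One of the positive and negative parts of [x j] is zero, and an odd [a] is positive, so the
    power of that part vanishes. What remains is [x j ^+ a], because [- (- x j) ^+ a = x j ^+ a] for
    odd [a]. *)
Lemma pn_factor_value I x j a : in_box I x ->
  meval (pn_point x) (pn_factor I j a) = x j ^+ a.
Proof.
move=> xI; rewrite /pn_factor; case: ifPn => odda; last first.
  by rewrite meval_symXn pn_point_sym.
have a0 : (0 < a)%N by case: a odda.
case: ifPn => [_|_].
  rewrite mevalB !meval_symXn pn_point_symp pn_point_symn.
  have [x0|x0] := leP 0 (x j).
    by rewrite max_r ?oppr_le0// expr0n -[a == 0%N]negbK -lt0n a0 subr0.
  rewrite max_l ?oppr_ge0 ?ltW// expr0n -[a == 0%N]negbK -lt0n a0.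
  by rewrite exprNn -signr_odd odda mulN1r sub0r opprK.
case: ifPn => [/asboolP neg|_]; last by rewrite meval_symXn pn_point_sym.
rewrite mevalN meval_symXn pn_point_symn max_l ?oppr_ge0 ?neg//.
by rewrite exprNn -signr_odd odda mulN1r opprK.
Qed.

(** Even powers and powers of the symbols for positive and negative parts are nonnegative. An odd
    power of [x j] itself survives only if [I j] is neither mixed nor contained in the nonpositive
    reals; then it has a positive element, hence no negative one. *)
Lemma pn_factor_terms_ge0 I x j a : in_box I x ->
  terms_ge0 (pn_point x) (pn_factor I j a).
Proof.
move=> xI; rewrite /pn_factor; case: ifPn => odda; last first.
  by apply: terms_ge0_Xn; rewrite pn_point_sym exprn_even_ge0.
case: ifPn => [_|/asboolPn mixed].
  by apply: terms_ge0D; last apply: terms_ge0N;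
    apply: terms_ge0_Xn; rewrite exprn_ge0 ?pn_point_symp_ge0 ?pn_point_symn_ge0.
case: ifPn => [_|/asboolPn notneg].
  by apply/terms_ge0N/terms_ge0_Xn; rewrite exprn_ge0 ?pn_point_symn_ge0.
apply: terms_ge0_Xn; rewrite pn_point_sym exprn_ge0// leNgt; apply/negP => xj0.
apply: mixed; split; last by exists (x j).
apply: contrapT => nopos; apply: notneg => y yI; rewrite leNgt; apply/negP => y0.
by apply: nopos; exists y.
Qed.

Lemma pn_subst_value I x (g : mpoly m R) : in_box I x ->
  pn_value (pn_subst I g) x = meval x g.
Proof.
move=> xI; rewrite /pn_value /pn_subst raddf_sum mevalE; apply: eq_bigr => M _ /=.
rewrite mevalZ rmorph_prod; congr (_ * _).
by apply: eq_bigr => j _; exact: pn_factor_value.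
Qed.

Lemma pn_subst_terms_ge0 I x (g : mpoly m R) : in_box I x ->
  terms_ge0 (pn_point x) (pn_subst I g).
Proof.
move=> xI; apply: terms_ge0_sum => M; apply: terms_ge0Z.
by apply: terms_ge0_prod => j; exact: pn_factor_terms_ge0.
Qed.

(** This is the rule that the product of the positive and negative parts of [x j] is zero, which
    makes the optional simplification harmless. *)
Lemma meval_mixed_monomial x (M : multinom (pn_nsym m)) j :
  (0 < M (symp j))%N -> (0 < M (symn j))%N ->
  meval (pn_point x) (mpolyX R M) = 0.
Proof.
move=> Mp Mn; rewrite mevalX; apply/eqP/prodf_eq0.
have [x0|x0] := leP 0 (x j).
  exists (symn j) => //; rewrite pn_point_symn max_r ?oppr_le0//.
  by rewrite expr0n -[_ == 0%N]negbK -lt0n Mn.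
exists (symp j) => //; rewrite pn_point_symp max_r ?ltW//.
by rewrite expr0n -[_ == 0%N]negbK -lt0n Mp.
Qed.

Lemma pn_simplifies_terms_ge0 v q q' : pn_simplifies q q' ->
  terms_ge0 v q -> terms_ge0 v q'.
Proof.
move=> sq tq M; rewrite mcoeff_msupp => M0; apply: tq.
rewrite mcoeff_msupp; case: (sq M) => [<- //|[M00]].
by rewrite M00 eqxx in M0.
Qed.

(** The difference [q' - q] is supported on mixed monomials, and these vanish at every
    [pn_point]. *)
Lemma pn_simplifies_value x q q' : pn_simplifies q q' ->
  pn_value q' x = pn_value q x.
Proof.
move=> sq; apply/eqP; rewrite -subr_eq0 /pn_value -mevalB; apply/eqP.
rewrite [q' - q]mpolyE raddf_sum big1_seq// => M _ /=.
rewrite mevalZ mcoeffB; case: (sq M) => [->|[_ [j [Mp Mn]]]].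
  by rewrite subrr mul0r.
by rewrite (meval_mixed_monomial _ _ _ Mp Mn) mulr0.
Qed.

(** Triangle inequality over the terms: with a nonnegative monomial, the absolute value of a term
    only changes the sign of a negative coefficient, as does [neg_terms]. *)
Lemma pn_value_terms_le x q : terms_ge0 (pn_point x) q ->
  `|pn_value q x| <= pn_value (pos_terms q + neg_terms q) x.
Proof.
move=> tq; rewrite /pn_value.
rewrite {1}[q]mpolyE /pos_terms /neg_terms mevalB !(raddf_sum (meval _)) /=.
(* Both filtered sums become sums over the whole support, with 0 where the filter fails, so that the
   comparison can be made term by term. *)
rewrite [X in _ <= X - _]big_mkcond [X in _ <= _ - X]big_mkcond /=.
rewrite -sumrB.
apply: (le_trans (ler_norm_sum _ _ _)).
rewrite !big_seq; apply: ler_sum => M /tq M0.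
rewrite mevalZ normrM (ger0_norm M0).
case: ltgtP => [c0|c0|<-]; rewrite ?subr0 ?sub0r ?normr0 ?mul0r//.
- by rewrite gtr0_norm.
- by rewrite ltr0_norm// mulNr.
Qed.

Lemma PN_output_ge I k (g : 'I_k -> mpoly m R) p x : PN_output I g p ->
  in_box I x -> \sum_(i < k) `|meval x (g i)| <= pn_value p x.
Proof.
move=> [q [sq ->]] xI; rewrite /pn_value raddf_sum /=; apply: ler_sum => i _.
rewrite -(pn_subst_value I x)// -(pn_simplifies_value x _ _ (sq i)).
apply: pn_value_terms_le; apply: pn_simplifies_terms_ge0 (sq i) _.
exact: pn_subst_terms_ge0.
Qed.

End PNValue.

(** * Bounded measurable functions, and a tail bound by the flag *)

Section BoundedMeasurable.
Context {d : measure_display} {T : measurableType d} {R : realType}.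
Implicit Types (Y Z : T -> R).

(** This class is closed under the ring operations and contained in the integrable functions, so it
    settles the existence of all the moments at once. *)
Definition bounded_mfun Y : Prop :=
  measurable_fun setT Y /\ exists B, forall w, `|Y w| <= B.

Lemma bounded_mfun_cst (a : R) : bounded_mfun (fun=> a).
Proof. by split; [exact: measurable_cst | exists `|a|]. Qed.

Lemma bounded_mfunD Y Z : bounded_mfun Y -> bounded_mfun Z ->
  bounded_mfun (fun w => Y w + Z w).
Proof.
move=> [mY [B YB]] [mZ [C ZC]]; split; first exact: measurable_funD.
by exists (B + C) => w; rewrite (le_trans (ler_normD _ _))// lerD.
Qed.

Lemma bounded_mfunM Y Z : bounded_mfun Y -> bounded_mfun Z ->
  bounded_mfun (fun w => Y w * Z w).
Proof.
move=> [mY [B YB]] [mZ [C ZC]]; split; first exact: measurable_funM.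
by exists (B * C) => w; rewrite normrM ler_pM.
Qed.

Lemma bounded_mfunB Y Z : bounded_mfun Y -> bounded_mfun Z ->
  bounded_mfun (fun w => Y w - Z w).
Proof.
move=> [mY [B YB]] [mZ [C ZC]]; split; first exact: measurable_funB.
by exists (B + C) => w; rewrite (le_trans (ler_normB _ _))// lerD.
Qed.

Lemma bounded_mfunX Y k : bounded_mfun Y -> bounded_mfun (fun w => Y w ^+ k).
Proof.
move=> [mY [B YB]]; split; first exact: measurable_funX.
by exists (B ^+ k) => w; rewrite normrX lerXn2r// ?nnegrE ?(le_trans _ (YB w)).
Qed.

Lemma bounded_mfun_sum (A : Type) (r : seq A) (F : A -> T -> R) :
  (forall i, bounded_mfun (F i)) -> bounded_mfun (fun w => \sum_(i <- r) F i w).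
Proof.
move=> bF; elim: r => [|i r IHr].
  by under eq_fun do rewrite big_nil; exact: bounded_mfun_cst.
by under eq_fun do rewrite big_cons; exact: bounded_mfunD.
Qed.

Lemma bounded_mfun_prod (A : Type) (r : seq A) (F : A -> T -> R) :
  (forall i, bounded_mfun (F i)) ->
  bounded_mfun (fun w => \prod_(i <- r) F i w).
Proof.
move=> bF; elim: r => [|i r IHr].
  by under eq_fun do rewrite big_nil; exact: bounded_mfun_cst.
by under eq_fun do rewrite big_cons; exact: bounded_mfunM.
Qed.

Lemma bounded_mfun_max0 Y :
  bounded_mfun Y -> bounded_mfun (fun w => Num.max (Y w) 0).
Proof.
move=> [mY [B YB]]; split; first exact: measurable_maxr.
exists B => w; apply: le_trans (YB w).
by rewrite maxEle; case: ifP => _; rewrite ?normr0 ?normr_ge0.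
Qed.

Lemma bounded_mfun_integrable (P : probability T R) Y :
  bounded_mfun Y -> P.-integrable setT (EFin \o Y).
Proof.
move=> [mY [B YB]]; apply: measurable_bounded_integrable => //.
  by rewrite (le_lt_trans (probability_le1 P _)) ?ltry.
exists B; split; first exact: num_real.
by move=> C BC w _; exact: le_trans (YB w) (ltW BC).
Qed.

Lemma expectE (P : probability T R) Y : expect P Y = \int[P]_w Y w.
Proof. by rewrite /expect unlock. Qed.

(** Inversion is continuous away from 0, and the remaining piece is the single point 0, where the
    value is 0 by convention. *)
Lemma measurable_invr : measurable_fun setT (@GRing.inv R).
Proof.
rewrite -(setvU [set 0 : R]); apply/measurable_funU => //.
  exact: measurableC.
split; last exact: measurable_fun_set1.
rewrite (_ : ~` _ = [set y | y != 0]); last first.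
  by apply/seteqP; split => y /= /eqP.
apply: open_continuous_measurable_fun; first exact: open_neq.
by move=> y; rewrite inE; exact: inv_continuous.
Qed.

Lemma measurable_ge Y (a : R) :
  measurable_fun setT Y -> measurable [set w | a <= Y w].
Proof.
move=> mY; have := mY measurableT _ (measurable_itv `[a, +oo[).
rewrite setTI; congr measurable.
by apply/seteqP; split => w /=; rewrite in_itv /= andbT.
Qed.

(* Markov's inequality for the n-th central moment: since the mean is negative,
   [0 <= Y] forces [expect P Y ^+ n <= (Y - expect P Y) ^+ n]. *)
Lemma flag_bound (P : probability T R) (n : nat) Y :
  ~~ odd n -> bounded_mfun Y -> expect P Y < 0 ->
  (P [set w | (0 <= Y w)%R] <= (flag P n Y)%:E)%E.
Proof.
move=> en bY Y0; set mu := expect P Y.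
have mun0 : 0 < mu ^+ n by rewrite lt0r exprn_even_ge0// expf_neq0// lt_eqF.
pose G w := (Y w - mu) ^+ n.
have bG : bounded_mfun G by exact/bounded_mfunX/bounded_mfunB/bounded_mfun_cst.
have G0 w : 0 <= G w by exact: exprn_even_ge0.
have iG := bounded_mfun_integrable P _ bG.
have mG : measurable_fun setT (EFin \o G) by case/integrableP: iG.
have /= := le_integral_abse P measurableT mG mun0.
rewrite setTI; under eq_integral do rewrite ger0_norm//.
move=> markovG.
rewrite /flag -/mu EFinM muleC lee_pdivlMl//.
rewrite -[expect P _]/(fine 'E_P[G])%E unlock fineK ?integrable_fin_num//.
apply: le_trans markovG; rewrite lee_pmul2l// le_measure ?inE//.
- by case: bY => /measurable_ge.
- rewrite (_ : [set _ | _] = [set w | mu ^+ n <= G w]).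
    by case: bG => /measurable_ge.
  by apply/seteqP; split => w /=; rewrite ger0_norm ?lee_fin.
- move=> w /= Yw; rewrite ger0_norm// lee_fin.
  (* As [n] is even, [mu] may be replaced by [- mu]; powers are then compared on nonnegative reals,
     where [- mu <= Y w - mu]. *)
  have -> : mu ^+ n = (- mu) ^+ n.
    by rewrite exprNn -signr_odd (negbTE en) expr0 mul1r.
  have mu0 : mu <= 0 by exact: ltW.
  by rewrite lerXn2r ?nnegrE ?lerDr ?subr_ge0 ?oppr_ge0// (le_trans mu0).
Qed.
End BoundedMeasurable.

(** * Measurability and boundedness of expressions in random inputs *)

Section MeasurableExpressions.
Context {d : measure_display} {T : measurableType d} {R : realType} {m : nat}.
Implicit Types (t : expr R m) (x : T -> 'I_m -> R).

Lemma measurable_op_eval o (Y Z : T -> R) :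
  measurable_fun setT Y -> measurable_fun setT Z ->
  measurable_fun setT (fun w => op_eval o (Y w) (Z w)).
Proof.
move=> mY mZ; case: o => /=.
- exact: measurable_funD.
- exact: measurable_funB.
- exact: measurable_funM.
- by apply: measurable_funM => //; exact: measurableT_comp measurable_invr mZ.
Qed.

Lemma measurable_fl_eval t x (e f : T -> 'I_(nops t) -> R) :
  (forall j, measurable_fun setT (x ^~ j)) ->
  (forall i, measurable_fun setT (e ^~ i)) ->
  (forall i, measurable_fun setT (f ^~ i)) ->
  measurable_fun setT (fun w => fl_eval t (x w) (e w) (f w)).
Proof.
move=> mx; elim: t e f => [j|a|o a IHa b IHb] e f me mf /=.
- exact: mx.
- exact: measurable_cst.
apply: measurable_funD; last exact: mf.
apply: measurable_funM; last by apply: measurable_funD; last exact: me.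
apply: measurable_op_eval.
- apply: (IHa (fun w => lft_errs (e w)) (fun w => lft_errs (f w))) => i.
    exact: me.
  exact: mf.
- apply: (IHb (fun w => rgt_errs (e w)) (fun w => rgt_errs (f w))) => i.
    exact: me.
  exact: mf.
Qed.

Lemma measurable_expr_eval t x :
  (forall j, measurable_fun setT (x ^~ j)) ->
  measurable_fun setT (fun w => expr_eval t (x w)).
Proof.
move=> mx; under eq_fun do rewrite -fl_eval0.
by apply: measurable_fl_eval => // i; exact: measurable_cst.
Qed.

Lemma is_constant_eval t (y z : 'I_m -> R) :
  is_constant t -> expr_eval t y = expr_eval t z.
Proof. by elim: t => //= o a IHa b IHb /andP[/IHa -> /IHb ->]. Qed.

(** The only divisors are constant subexpressions, whose inverse is a fixed real number; everything
    else is a ring operation. *)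
Lemma division_free_bounded_mfun t x : division_free t ->
  (forall j, bounded_mfun (x ^~ j)) ->
  bounded_mfun (fun w => expr_eval t (x w)).
Proof.
move=> + bx; elim: t => [j|a|o a IHa b IHb] //=.
- by move=> _; exact: bounded_mfun_cst.
case: o => /=.
- by move=> /andP[/IHa ba /IHb bb]; exact: bounded_mfunD.
- by move=> /andP[/IHa ba /IHb bb]; exact: bounded_mfunB.
- by move=> /andP[/IHa ba /IHb bb]; exact: bounded_mfunM.
- move=> /and3P[/IHa ba _ cb]; apply: bounded_mfunM => //.
  under eq_fun do rewrite (is_constant_eval _ _ (fun=> 0) cb).
  exact: bounded_mfun_cst.
Qed.

Lemma pn_value_bounded_mfun (p : mpoly (pn_nsym m) R) x :
  (forall j, bounded_mfun (x ^~ j)) ->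
  bounded_mfun (fun w => pn_value p (x w)).
Proof.
move=> bx; apply: bounded_mfun_sum => M; apply: bounded_mfunM.
  exact: bounded_mfun_cst.
apply: bounded_mfun_prod => s; apply: bounded_mfunX; rewrite /pn_point.
case: fintype.split => [s'|j]; first case: fintype.split => [j|j] //.
- exact: bounded_mfun_max0.
- apply: bounded_mfun_max0; under eq_fun do rewrite -sub0r.
  exact/bounded_mfunB/bx/bounded_mfun_cst.
Qed.

End MeasurableExpressions.

(* On an error of size at least [U1 + U2] the first-order part is at least
   [U1]; multiplying by [Q ^ 2] turns it into a sum dominated by [p]. *)
Lemma large_fl_err_PN {R : realType} {m : nat} (I : 'I_m -> interval R)
    (eps U1 U2 : R) (N Q : expr R m)
    (h : 'I_(nops (Op Div N Q)) -> mpoly m R) (p : mpoly (pn_nsym m) R)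
    (y : 'I_m -> R) (e d : 'I_(nops (Op Div N Q)) -> R) :
  in_box I y -> 0 <= eps -> (forall i, `|e i| <= eps) ->
  (forall i, meval y (h i) = fl_partial (Op Div N Q) y i * expr_eval Q y ^+ 2) ->
  PN_output I h p ->
  `|remainder2 (Op Div N Q) y e d| <= U2 ->
  U1 + U2 <= fl_err (Op Div N Q) y e d ->
  0 <= pn_value p y * eps - expr_eval Q y ^+ 2 * U1.
Proof.
move=> yI eps0 eeps hE PN r2 errU; rewrite subr_ge0.
set f := Op Div N Q in h e d eeps hE PN r2 errU *.
(* The error splits into the first-order sum and the remainder; the remainder takes up at most [U2],
   and each [e i] is at most [eps] in absolute value. *)
have U1le : U1 <= \sum_i `|fl_partial f y i| * eps.
  rewrite -(lerD2r U2) (le_trans errU)//.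
  have -> : fl_err f y e d =
      `|\sum_i fl_partial f y i * e i + remainder2 f y e d|.
    by rewrite /fl_err /remainder2 [X in _ = `|X|]addrC subrK.
  rewrite (le_trans (ler_normD _ _))// lerD// (le_trans (ler_norm_sum _ _ _))//.
  by apply: ler_sum => i _; rewrite normrM ler_wpM2l.
apply: (@le_trans _ _ ((\sum_i `|meval y (h i)|) * eps)); last first.
  by rewrite ler_wpM2r//; exact: PN_output_ge PN yI.
rewrite mulr_suml (le_trans (ler_wpM2l (sqr_ge0 _) U1le))//.
rewrite mulr_sumr le_eqVlt; apply/orP; left; apply/eqP/eq_bigr => i _.
by rewrite hE normrM (ger0_norm (sqr_ge0 _)) mulrCA mulrA.
Qed.

Theorem theorem4p7 (R : realType) (disp : measure_display)
    (T : measurableType disp) (P : probability T R) (m : nat)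
    (I : 'I_m -> interval R) (X : 'I_m -> {RV P >-> R})
    (eps delta : R) (N Q : expr R m)
    (h : 'I_(nops (Op Div N Q)) -> mpoly.mpoly m R)
    (p : mpoly.mpoly (pn_nsym m) R)
    (c : R) (n : nat) (U1 U2 : R) :
  let f := Op Div N Q in
  let x := fun (w : T) (j : 'I_m) => X j w in
  let K := fun (u : R) (w : T) =>
    pn_value p (x w) * eps - (expr_eval Q (x w)) ^+ 2 * u in
  let l := expect P (fun w => pn_value p (x w)) * eps /
           expect P (fun w => (expr_eval Q (x w)) ^+ 2) in
  let r := 10 ^+ 5 * l in
  let Ustar := U1 + U2 in
  (forall j, bounded_set [set` I j]) ->
  (forall j w, X j w \in I j) ->
  mutually_independent X ->
  0 < eps -> 0 < delta ->
  division_free N -> division_free Q ->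
  (forall y, in_box I y -> expr_eval Q y <> 0) ->
  (forall y e d, in_box I y -> admissible eps delta e d ->
     fl_defined f y e d) ->
  (forall i y, expr_eval Q y <> 0 ->
     mpoly.meval y (h i) = fl_partial f y i * (expr_eval Q y) ^+ 2) ->
  PN_output I h p ->
  0 < c < 1 ->
  (2 <= n)%N -> ~~ odd n ->
  l < U1 < r ->
  flag P n (K U1) <= 1 - c ->
  (forall y e d, in_box I y -> admissible eps delta e d ->
     `| remainder2 f y e d | <= U2) ->
  forall e d : 'I_(nops f) -> {RV P >-> R},
    {ae P, forall w, admissible eps delta (e ^~ w) (d ^~ w)} ->
    (P [set w | (Ustar <= fl_err f (x w) (e ^~ w) (d ^~ w))%R] <= (1 - c)%:E)%E.
Proof.
move=> f x K l r Ustar bI XI _ eps0 _ _ dfQ Q0 _ hE PN _ _ n_even /andP[lU1 U1r].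
move=> flag_le r2 e d adm.
have xI w : in_box I (x w) by move=> j; exact: XI.
have bx j : bounded_mfun (x ^~ j).
  split; first exact: measurable_funP.
  (* Boundedness of a set provides a [B] such that every number strictly above [B] is a bound, hence
     the choice of [B + 1]. *)
  have [B [_ IB]] := bI j; exists (B + 1) => w.
  by apply: (IB (B + 1)); [rewrite ltrDl | exact: XI].
have bQ2 : bounded_mfun (fun w => expr_eval Q (x w) ^+ 2).
  exact/bounded_mfunX/division_free_bounded_mfun.
have bp := pn_value_bounded_mfun p x bx.
have bpe : bounded_mfun (fun w => pn_value p (x w) * eps).
  exact/bounded_mfunM/bounded_mfun_cst.
have bQU : bounded_mfun (fun w => expr_eval Q (x w) ^+ 2 * U1).
  exact/bounded_mfunM/bounded_mfun_cst.
have bK : bounded_mfun (K U1) by exact: bounded_mfunB.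
have EQ0 : 0 < expect P (fun w => expr_eval Q (x w) ^+ 2).
  rewrite lt0r; apply/andP; split; last first.
    by rewrite expectE Rintegral_ge0// => w _; exact: sqr_ge0.
  (* otherwise [l = r = 0], because division by zero gives zero *)
  apply/eqP => EQ; move: (lt_trans lU1 U1r).
  by rewrite /r /l EQ invr0 !mulr0 ltxx.
(* By linearity the mean is [E[p] * eps - E[Q ^ 2] * U1]; since [E[Q ^ 2]] is positive, its
   negativity is exactly [l < U1]. *)
have EK0 : expect P (K U1) < 0.
  rewrite expectE RintegralB//; [|exact: bounded_mfun_integrable..].
  rewrite !RintegralZr//; [|exact: bounded_mfun_integrable..].
  by rewrite subr_lt0 -!expectE [ltRHS]mulrC -ltr_pdivrMr.
apply: (@le_trans _ _ (P [set w | 0 <= K U1 w])); last first.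
  by rewrite (le_trans (flag_bound P n _ n_even bK EK0)) ?lee_fin.
have mx j : measurable_fun setT (x ^~ j) by case: (bx j).
have mA : measurable [set w | Ustar <= fl_err f (x w) (e ^~ w) (d ^~ w)].
  apply: measurable_ge; apply: measurableT_comp => //.
  apply: measurable_funB; last exact: measurable_expr_eval.
  by apply: measurable_fl_eval => // i; exact: measurable_funP.
have mB : measurable [set w | 0 <= K U1 w] by case: bK => /measurable_ge.
(* Admissibility may fail on a null set [Z]. The large-error event lies in the union of [Z] and the
   event [0 <= K U1], so adding [P Z = 0] to the bound lets subadditivity conclude. *)
have [Z [mZ PZ0 Zadm]] := adm.
rewrite -[leRHS]adde0 -[X in (_ + X)%E]PZ0.
apply: le_trans (measureU2 _ _ _) => //.
apply: le_measure; rewrite ?inE//; first exact: measurableU.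
move=> w /= errw; have [Zw|nZw] := pselect (Z w); [by right|left].
have admw : admissible eps delta (e ^~ w) (d ^~ w).
  by apply: contrapT => nadm; exact/nZw/Zadm.
apply: (@large_fl_err_PN _ _ I eps U1 U2 N Q h p (x w) (e ^~ w) (d ^~ w)) => //.
- exact: ltW.
- by case: admw.
- by move=> i; apply: hE; exact: Q0.
- exact: r2.
Qed.
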